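(* Fix $\lambda\in\mathbb R$, $n\ge n_\lambda$, $q\ge1$, integers $k_1,\dots,k_q\ge1$ and $r_1,\dots,r_q\ge0$, and put $K=\sum_{i=1}^qk_i$, $R=\sum_{i=1}^qr_i$. If $K\le n$ and $k_i+r_i-1\le\binom{k_i}{2}$ for every $i$, then $$L_n(\mathbf k,\mathbf r)=\frac{(n)_K}{\prod_{i=1}^qk_i!}\prod_{i=1}^qc(k_i,k_i+r_i-1)\,p_n^{K+R-q}(1-p_n)^A,$$ where $$A=K(n-K)+\sum_{1\le i<j\le q}k_ik_j+\sum_{i=1}^q\left\{\binom{k_i}{2}-(k_i+r_i-1)\right\}=Kn-\frac{K^2}{2}-\frac{3K}{2}-R+q.$$ If these feasibility conditions fail, then $L_n(\mathbf k,\mathbf r)=0$.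
   Context: $p_n=n^{-1}+\lambda n^{-4/3}$, and $n_\lambda$ is a fixed integer such that $p_n\in(0,1)$ for all $n\ge n_\lambda$. $G(n,p)$ is the Erdős–Rényi random graph on $n$ labelled vertices, $\mathcal C(G)$ the set of connected components of $G$; for a component $C$, $|C|$ and $e(C)$ are its numbers of vertices and edges, and $\operatorname{sp}(C)=e(C)-|C|+1$. With $\mathbf k=(k_1,\dots,k_q)$, $\mathbf r=(r_1,\dots,r_q)$, $$L_n(\mathbf k,\mathbf r)=\mathbb E\sum^{\ne}_{C_1,\dots,C_q\in\mathcal C(G(n,p_n))}\prod_{i=1}^q\mathbf 1_{\{|C_i|=k_i,\ \operatorname{sp}(C_i)=r_i\}},$$ the sum over ordered $q$-tuples of distinct components. $c(k,m)$ is the number of connected labelled simple graphs on $k$ vertices with $m$ edges, and $(n)_K=n(n-1)\cdots(n-K+1)$. *)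

(* Defs.v *)
From HB Require Import structures.
From mathcomp Require Import all_boot all_order all_algebra.
From mathcomp Require Import reals exp.

Set Implicit Arguments.
Unset Strict Implicit.
Unset Printing Implicit Defensive.

Import Order.TTheory GRing.Theory Num.Theory.

Local Open Scope ring_scope.

(* A simple graph on the vertex set [T] is encoded by its set of edges, each
   edge being the set of its two endpoints. *)
Definition simple_graph (T : finType) (G : {set {set T}}) : bool :=
  [forall e in G, #|e| == 2%N].

Definition adj (T : finType) (G : {set {set T}}) : rel T :=
  [rel x y | [set x; y] \in G].

Definition connected_graph (T : finType) (G : {set {set T}}) : bool :=
  [forall x, forall y, connect (adj G) x y].

(* Components are represented by their vertex sets; a component is the subgraph
   induced on its vertex set, hence the definition of [nedges]. *)
Definition components (T : finType) (G : {set {set T}}) : {set {set T}} :=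
  equivalence_partition (connect (adj G)) [set: T].

Definition nedges (T : finType) (G : {set {set T}}) (C : {set T}) : nat :=
  #|[set e in G | e \subset C]|.

Definition sp (T : finType) (G : {set {set T}}) (C : {set T}) : int :=
  (nedges G C)%:Z - #|C|%:Z + 1.

(* c(k, m); only used for 0 < k (the graph without vertices counts as
   connected here). *)
Definition num_connected (k m : nat) : nat :=
  #|[set G : {set {set 'I_k}} |
      [&& simple_graph G, connected_graph G & #|G| == m]]|.

(* Each of the 'C(n, 2) potential edges is present with probability [p],
   independently of the others. *)
Definition er_prob (R : realType) (n : nat) (p : R) (G : {set {set 'I_n}}) : R :=
  \prod_(e : {set 'I_n} | #|e| == 2%N) (if e \in G then p else 1 - p).

Definition er_expectation (R : realType) (n : nat) (p : R)
    (X : {set {set 'I_n}} -> R) : R :=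
  \sum_(G : {set {set 'I_n}} | simple_graph G) er_prob p G * X G.

Definition p_crit (R : realType) (lambda : R) (n : nat) : R :=
  n%:R^-1 + lambda * n%:R `^ (- (4 / 3)).

Definition L (R : realType) (lambda : R) (n q : nat) (k r : 'I_q -> nat) : R :=
  er_expectation (p_crit lambda n) (fun G : {set {set 'I_n}} =>
    \sum_(C : {ffun 'I_q -> {set 'I_n}} |
           injectiveb C && [forall i, C i \in components G])
      \prod_(i < q) ((#|C i| == k i) && (sp G (C i) == (r i)%:Z))%:R).

(* Main.v *)
Require Import Defs.
From HB Require Import structures.
From mathcomp Require Import all_boot all_order all_algebra.
From mathcomp Require Import reals exp.
From mathcomp Require Import ring lra zify.

(** Exchange the expectation with the sum over tuples of vertex sets.  Distinct
    components are disjoint, so only tuples C of pairwise disjoint sets with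
    #|C i| = k i contribute.  For such a tuple, let U be the union of the C i;
    the potential edges split into those inside one C i, those inside the
    complement of U, and the cross pairs, which meet U but lie in no C i.  The
    C i are all components exactly when no cross pair is present and, for every
    i, the edges inside C i connect C i ([components_zones]).  These conditions
    bear on disjoint sets of edges, hence are independent
    ([sum_subsets_partition]), which gives the probability of the event as a
    product ([er_expectation_components]): with k = k i and m = k i + r i - 1,
    the set C i contributes c(k, m) p^m (1 - p)^('C(k, 2) - m), each cross pair
    contributes 1 - p, and the pairs outside U contribute 1.

    This probability depends on the sizes only, so it remains to multiply it by
    the number of disjoint tuples, which is n ^_ K / prod (k i)!
    ([card_disjoint_tuples]).  Cross pairs need no enumeration: their number is
    what is left of 'C(n, 2) once the other two kinds are removed, and expanding
    'C(n, 2) along n = (n - K) + sum k i turns it into K (n - K) + sum k i * k j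
    ([cross_pairsE]).

    The resulting formula ([L_formula]) holds without any feasibility condition:
    when K > n the falling factorial vanishes, and when some component would
    need more than 'C(k i, 2) edges the number of connected graphs vanishes. *)

Set Implicit Arguments.
Unset Strict Implicit.
Unset Printing Implicit Defensive.

Import Order.TTheory GRing.Theory Num.Theory.

Local Open Scope ring_scope.

(** * Independence over disjoint sets of edges *)

(** A subset G of D amounts to the family of its traces on the classes of [lab],
    so a sum over G of a product over the classes is an expanded product of
    sums.  Probabilistically: functions of the traces are independent. *)
Lemma sum_subsets_partition (R : comNzRingType) (E I : finType) (D : {set E})
    (lab : E -> I) (w : E -> bool -> R) (f : I -> {set E} -> R) :
  let F i := [set e in D | lab e == i] in
  \sum_(G : {set E} | G \subset D)
     (\prod_(e in D) w e (e \in G)) * \prod_i f i (G :&: F i)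
  = \prod_i \sum_(H : {set E} | H \subset F i)
       (\prod_(e in F i) w e (e \in H)) * f i H.
Proof.
move=> F; rewrite bigA_distr_big_dep.
pose cut (G : {set E}) := [ffun i => G :&: F i].
pose glue (h : {ffun I -> {set E}}) := \bigcup_i h i.
have glueK (G : {set E}) : G \subset D -> glue (cut G) = G.
  move=> sGD; apply/setP => e; apply/bigcupP/idP => [[i _]|eG].
    by rewrite ffunE inE => /andP[].
  by exists (lab e) => //; rewrite ffunE !inE eG (subsetP sGD) ?eqxx.
have cutK (h : {ffun I -> {set E}}) :
    (forall i, h i \subset F i) -> cut (glue h) = h.
  move=> hF; apply/ffunP => i; rewrite ffunE; apply/setP => e; rewrite inE.
  apply/andP/idP => [[/bigcupP[j _ ej] ei]|ei]; last first.
    by rewrite (subsetP (hF i)) //; split=> //; apply/bigcupP; exists i.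
  have := subsetP (hF j) _ ej; move: ei; rewrite !inE.
  by case/andP=> _ /eqP <- /andP[_ /eqP->].
rewrite (reindex_onto glue cut) //; apply: eq_big => [h | h /andP[_ /eqP hK]].
  apply/andP/familyP => [[hD /eqP<-] i|hF].
    by rewrite ffunE; apply: subsetIr.
  split; last by apply/eqP/cutK.
  apply/bigcupsP => i _; apply: subset_trans (hF i) _.
  by apply/subsetP => e; rewrite inE => /andP[].
rewrite (partition_big lab predT) //= -big_split /=; apply: eq_bigr => i _.
have hE : glue h :&: F i = h i by rewrite -[in RHS]hK ffunE.
rewrite hE; congr (_ * _); apply: eq_big => [e|e /andP[eD /eqP ei]].
  by rewrite !inE.
by rewrite -hE !inE eD ei eqxx !andbT.
Qed.

(** The weights form a probability distribution: expand the product of the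
    factors p + (1 - p). *)
Lemma sum_subsets_weight (R : comNzRingType) (E : finType) (D : {set E})
    (p : R) :
  \sum_(H : {set E} | H \subset D)
     \prod_(e in D) (if e \in H then p else 1 - p) = 1.
Proof.
have := @bigA_distr R 0 1 *%R +%R E (fun e => if e \in D then p else 0)
  (fun e => if e \in D then 1 - p else 1).
rewrite big1 => [h|e _]; last first.
  by case: ifP => _ /=; [rewrite addrC subrK | rewrite add0r].
(* Subsets that are not included in D vanish, one of their factors being 0. *)
rewrite [RHS]h big_mkcond; apply: eq_big => [H|H _] //; case: ifP => [sHD|/subsetPn[e eH eD]].
  rewrite big_mkcond; apply: eq_bigr => e _; case: (boolP (e \in H)) => [eH|_].
    by rewrite (subsetP sHD).
  by [].
by rewrite (bigD1 e) //= eH (negPf eD) mul0r.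
Qed.

Lemma prod_weight (R : comNzRingType) (E : finType) (D H : {set E}) (p : R) :
  H \subset D ->
  \prod_(e in D) (if e \in H then p else 1 - p)
  = p ^+ #|H| * (1 - p) ^+ (#|D| - #|H|).
Proof.
move=> sHD; rewrite (big_setID H) /= (setIidPr sHD); congr (_ * _).
  by rewrite -prodr_const; apply: eq_bigr => e ->.
have -> : (#|D| - #|H|)%N = #|D :\: H| by rewrite cardsD (setIidPr sHD).
rewrite -prodr_const; apply: eq_bigr => e; rewrite inE => /andP[/negPf-> _].
by [].
Qed.

(** * Components *)

Definition edges_in (T : finType) (C : {set T}) : {set {set T}} :=
  [set e : {set T} | e \subset C & #|e| == 2%N].

(** Connectivity of C in H.  Paths are not required to stay in C, so this is the
    connectivity of a subgraph on C when all edges of H lie inside C. *)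
Definition spans (T : finType) (C : {set T}) (H : {set {set T}}) : bool :=
  [forall x in C, forall y in C, connect (adj H) x y].

Lemma spansP (T : finType) (C : {set T}) (H : {set {set T}}) :
  reflect {in C &, forall x y, connect (adj H) x y} (spans C H).
Proof.
apply: (iffP forall_inP) => [h x y xC|h x xC].
  by have /forall_inP := h x xC; apply.
by apply/forall_inP => y; apply: h.
Qed.

Lemma card_edges_in (T : finType) (C : {set T}) : #|edges_in C| = 'C(#|C|, 2).
Proof. exact: cards_draws. Qed.

Lemma simple_graphE (T : finType) (G : {set {set T}}) :
  simple_graph G = (G \subset edges_in [set: T]).
Proof.
apply/forall_inP/subsetP => h e /h; first by rewrite inE subsetT.
by rewrite inE => /andP[].
Qed.

Lemma adj_sym (T : finType) (G : {set {set T}}) : symmetric (adj G).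
Proof. by move=> x y; rewrite /adj /= setUC. Qed.

Lemma connect_adj_sym (T : finType) (G : {set {set T}}) : connect_sym (adj G).
Proof. exact/sym_connect_sym/adj_sym. Qed.

Lemma connect_adj_equiv (T : finType) (G : {set {set T}}) :
  {in [set: T] & &, equivalence_rel (connect (adj G))}.
Proof.
move=> x y z _ _ _; split=> // xy.
exact: (same_connect (@connect_adj_sym _ G) xy).
Qed.

Lemma components_partition (T : finType) (G : {set {set T}}) :
  partition (components G) [set: T].
Proof. exact: equivalence_partitionP (@connect_adj_equiv _ G). Qed.

(** The absence of edges leaving C makes C closed under adjacency.  Hence, for a
    connected C, the class of any of its points is C; conversely, a path that
    starts in a component never leaves it, and so uses edges of C only. *)
Lemma mem_components (T : finType) (G : {set {set T}}) (C : {set T}) :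
  simple_graph G -> C != set0 ->
  (C \in components G) =
  [forall e in G, (e \subset C) || [disjoint e & C]]
  && spans C (G :&: edges_in C).
Proof.
move=> sG /set0Pn[x xC]; apply/idP/andP.
  move=> /imsetP[z _ CE].
  have CP y : (y \in C) = connect (adj G) z y by rewrite CE !inE.
  have cl e : e \in G -> (e \subset C) || [disjoint e & C].
    move=> eG; have /cards2P[a [b [_ eE]]] : #|e| == 2%N by apply: (forall_inP sG).
    have ab : (a \in C) = (b \in C).
      rewrite !CP (same_connect_r (@connect_adj_sym _ G) (y := b)) //.
      by apply: connect1; rewrite /adj /= -eE.
    rewrite eE subUset !sub1set -ab andbb disjoints_subset subUset !sub1set.
    by rewrite !inE -ab andbb orbN.
  split; first by apply/forall_inP.
  apply/spansP => a b; rewrite !CP => za zb.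
  have: connect (adj G) a b.
    by apply: connect_trans zb; rewrite connect_adj_sym.
  have {za} aC : a \in C by rewrite CP.
  case/connectP=> s; elim: s a aC => [|c s IHs] a aC /=.
    by move=> _ ->; apply: connect0.
  case/andP=> ac cs bE.
  have/orP[sub|dis] := cl _ ac; last first.
    by have := disjointFr dis (set21 a c); rewrite aC.
  have cC : c \in C by apply: (subsetP sub); rewrite set22.
  apply: connect_trans (IHs c cC cs bE); apply: connect1.
  by rewrite /adj /= !inE [[set a; c] \in G]ac sub (forall_inP sG).
case=> /forall_inP cl /spansP sp; apply/imsetP; exists x => //.
apply/setP => y; rewrite !inE; apply/idP/idP => [yC|].
  apply: connect_sub (sp x y xC yC) => a b.
  by rewrite /adj /= inE => /andP[ab _]; apply: connect1.
move/closed_connect <- => // {y}.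
apply: intro_closed; first exact: connect_adj_sym.
move=> a b /cl/orP[/subsetP sub _|dis aC]; first by apply: sub; rewrite set22.
by have := disjointFr dis (set21 a b); rewrite aC.
Qed.

(** * Counting connected subgraphs and disjoint tuples *)

Lemma connect_imset (S T : finType) (g : S -> T) (G : {set {set S}}) x y :
  injective g ->
  connect (adj [set g @: e | e : {set S} in G]) (g x) (g y)
  = connect (adj G) x y.
Proof.
move=> gI; have gsI : injective (fun e : {set S} => g @: e) by apply: imset_inj.
have adjE a b : adj [set g @: e | e : {set S} in G] (g a) (g b) = adj G a b.
  by rewrite /adj /= -!imset_set1 -imsetU mem_imset.
apply/connectP/connectP => -[s].
  elim: s x => [|c s IHs] x /=; first by move=> _ /gI->; exists [::].
  case/andP=> xc.
  (* A vertex adjacent to g x belongs to the image of an edge, hence to that of g. *)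
  have [c' cE] : exists c', c = g c'.
    have /imsetP[e _ eE] := xc; have : c \in g @: e by rewrite -eE set22.
    by case/imsetP=> c' _ ->; exists c'.
  rewrite {}cE in xc * => cs yE; have [s' s'P s'y] := IHs _ cs yE.
  by exists (c' :: s') => //=; rewrite -adjE xc.
elim: s x => [|c s IHs] x /=; first by move=> _ ->; exists [::].
case/andP=> xc cs yE; have [s' s'P s'y] := IHs _ cs yE.
by exists (g c :: s') => //=; rewrite adjE xc.
Qed.

(** Transport along the enumeration of C, which is a bijection between the
    graphs on 'I_#|C| and those with all edges inside C. *)
Lemma card_spanning_subgraphs (T : finType) (C : {set T}) (m : nat) :
  #|[set H : {set {set T}} | H \subset edges_in C & spans C H && (#|H| == m)]|
  = num_connected #|C| m.
Proof.
pose g (i : 'I_#|C|) : T := enum_val i.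
have gI : injective g by apply: enum_val_inj.
have gC i : g i \in C by apply: enum_valP.
have gimC x : x \in C -> exists i, x = g i.
  by move=> xC; exists (enum_rank_in xC x); rewrite /g enum_rankK_in.
have gsI : injective (fun e : {set 'I_#|C|} => g @: e) by apply: imset_inj.
pose F (G : {set {set 'I_#|C|}}) := [set g @: e | e : {set 'I_#|C|} in G].
have FI : injective F by apply: imset_inj.
rewrite /num_connected -(card_imset _ FI); apply: eq_card => H.
have FE G : (F G \subset edges_in C) = simple_graph G.
  apply/subsetP/forall_inP => h e.
    by move=> eG; have := h _ (imset_f _ eG); rewrite inE card_imset // => /andP[].
  case/imsetP=> e' /h e'2 ->; rewrite inE card_imset // e'2 andbT.
  by apply/subsetP => _ /imsetP[i _ ->].
have FC G : spans C (F G) = connected_graph G.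
  apply/spansP/forallP => h x.
    by apply/forallP => y; rewrite -(connect_imset _ _ _ gI) h.
  by move=> y /gimC[i ->] /gimC[j ->]; rewrite connect_imset //; apply/forallP.
have Fm G : #|F G| = #|G| by rewrite card_imset.
apply/idP/imsetP => [|[G GP ->]]; last first.
  by move: GP; rewrite !inE FE FC Fm.
rewrite inE => HP; have [G HE] : exists G, H = F G.
  exists [set e : {set 'I_#|C|} | g @: e \in H]; apply/setP => e; apply/idP/imsetP => [eH|].
    exists (g @^-1: e); last first.
      apply/setP => x; apply/idP/imsetP => [xe|[i ie ->]].
        have /gimC[i iE] : x \in C.
          have /andP[/subsetP sHC _] := HP; have := sHC _ eH; rewrite inE.
          by case/andP=> /subsetP ->.
        by exists i => //; rewrite inE -iE.
      by move: ie; rewrite inE.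
    rewrite inE; suff -> : g @: (g @^-1: e) = e by [].
    apply/setP => x; apply/imsetP/idP => [[i ie ->]|xe].
      by move: ie; rewrite inE.
    have /gimC[i iE] : x \in C.
      have /andP[/subsetP sHC _] := HP; have := sHC _ eH; rewrite inE.
      by case/andP=> /subsetP ->.
    by exists i => //; rewrite inE -iE.
  by case=> e' ; rewrite inE => ? ->.
by exists G => //; move: HP; rewrite HE FE FC Fm inE.
Qed.

Definition disjoint_family (I T : finType) (C : {ffun I -> {set T}}) : bool :=
  [forall i, forall j, (i != j) ==> [disjoint C i & C j]].

Lemma disjoint_familyP (I T : finType) (C : {ffun I -> {set T}}) :
  reflect (forall i j, i != j -> [disjoint C i & C j]) (disjoint_family C).
Proof.
apply: (iffP forallP) => h i; first by move=> j; move/forallP: (h i) => /(_ j)/implyP.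
by apply/forallP => j; apply/implyP/h.
Qed.

Definition disjoint_tuples (q : nat) (T : finType) (V : {set T})
    (k : 'I_q -> nat) : {set {ffun 'I_q -> {set T}}} :=
  [set C : {ffun 'I_q -> {set T}} | disjoint_family C
     & [forall i, (C i \subset V) && (#|C i| == k i)]].

Lemma in_disjoint_tuples (q : nat) (T : finType) (V : {set T})
    (k : 'I_q -> nat) (C : {ffun 'I_q -> {set T}}) :
  (C \in disjoint_tuples V k)
  = disjoint_family C && [forall i, (C i \subset V) && (#|C i| == k i)].
Proof. by rewrite inE. Qed.

Lemma ffactD (n a b : nat) : (n ^_ (a + b) = n ^_ a * (n - a) ^_ b)%N.
Proof.
elim: a n => [|a IHa] n; first by rewrite mul1n subn0.
case: n => [|n]; first by rewrite !ffact0n.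
by rewrite addSn !ffactSS IHa subSS mulnA.
Qed.

(** Choose the first set B among the subsets of V of size k ord0, then the
    other sets in V minus B.  The product of factorials on the left keeps the
    identity free of divisions; both sides are 0 if V is too small. *)
Lemma card_disjoint_tuples (q : nat) (T : finType) (V : {set T})
    (k : 'I_q -> nat) :
  (#|disjoint_tuples V k| * \prod_(i < q) (k i)`! = #|V| ^_ (\sum_(i < q) k i))%N.
Proof.
elim: q V k => [|q IHq] V k.
  rewrite !big_ord0 muln1 (_ : disjoint_tuples V k = setT) ?cardsT ?card_ffun ?card_ord //.
  apply/setP => C; rewrite in_disjoint_tuples inE; apply/andP; split; last by apply/forallP => -[].
  by apply/disjoint_familyP => -[].
rewrite !big_ord_recl; set k' := fun i : 'I_q => k (lift ord0 i).
pose first (C : {ffun 'I_q.+1 -> {set T}}) := C ord0.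
pose tail (C : {ffun 'I_q.+1 -> {set T}}) := [ffun i : 'I_q => C (lift ord0 i)].
pose X := [set B : {set T} | B \subset V & #|B| == k ord0].
have fibre B : B \in X ->
    #|[set C in disjoint_tuples V k | first C == B]|
    = #|disjoint_tuples (V :\: B) k'|.
  rewrite inE => /andP[BV Bk].
  rewrite -(card_in_imset (f := tail)); last first.
    move=> C C'; rewrite !inE => /andP[_ /eqP CB] /andP[_ /eqP CB'] tE.
    apply/ffunP => i; case: (unliftP ord0 i) => [j|] ->.
      by have /ffunP/(_ j) := tE; rewrite !ffunE.
    by rewrite -/(first C) CB -CB'.
  apply: eq_card => D; apply/imsetP/idP.
    case=> C; rewrite inE in_disjoint_tuples => /andP[/andP[/disjoint_familyP dC /forallP kC]].
    move=> /eqP CB ->; rewrite in_disjoint_tuples; apply/andP; split.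
      apply/disjoint_familyP => i j ij; rewrite !ffunE; apply: dC.
      by rewrite (inj_eq lift_inj).
    apply/forallP => i; have /andP[iV ik] := kC (lift ord0 i).
    by rewrite ffunE subsetD iV ik andbT -CB dC.
  rewrite in_disjoint_tuples => /andP[/disjoint_familyP dD /forallP kD].
  pose C := [ffun i => if unlift ord0 i is Some j then D j else B].
  have C0 : C ord0 = B by rewrite ffunE unlift_none.
  have CS j : C (lift ord0 j) = D j by rewrite ffunE liftK.
  have tC : D = tail C by apply/ffunP => j; rewrite ffunE CS.
  exists C => //; rewrite inE in_disjoint_tuples /first C0 eqxx andbT; apply/andP; split.
    apply/disjoint_familyP => i j.
    have dB l : [disjoint D l & B].
      by have := kD l; rewrite subsetD => /andP[/andP[]].
    case: (unliftP ord0 i) => [i'|] ->; case: (unliftP ord0 j) => [j'|] ->.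
    - by rewrite (inj_eq lift_inj) !CS; apply: dD.
    - by rewrite C0 CS.
    - by rewrite C0 CS disjoint_sym.
    - by rewrite eqxx.
  apply/forallP => i; case: (unliftP ord0 i) => [i'|] ->; last by rewrite C0 BV.
  by have := kD i'; rewrite subsetD CS => /andP[/andP[-> _] ->].
have -> : #|disjoint_tuples V k|
    = (\sum_(B in X) #|disjoint_tuples (V :\: B) k'|)%N.
  rewrite -sum1_card (partition_big first (mem X)) => [|C]; last first.
    by rewrite in_disjoint_tuples => /andP[_ /forallP/(_ ord0)] h; rewrite /= inE.
  apply: eq_bigr => B /fibre <-; rewrite -sum1dep_card; apply: eq_bigl => C.
  by [].
rewrite big_distrl /=.
(* 'C(v, a) * a! * (v - a) ^_ b = v ^_ (a + b), with v = #|V|. *)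
rewrite (eq_bigr (fun=> (k ord0)`! * (#|V| - k ord0) ^_ (\sum_i k' i)))%N.
  by rewrite sum_nat_const cards_draws mulnA bin_ffact ffactD.
move=> B; rewrite inE => /andP[BV /eqP Bk].
rewrite mulnCA IHq cardsD (setIidPr BV) Bk.
by [].
Qed.

(** * Probability that given disjoint sets are components *)

Section Zones.

Variables (I T : finType) (C : {ffun I -> {set T}}).

(** The kind of a potential edge: [inl i] inside C i, [inr true] outside the
    union of the C i, [inr false] for a cross pair. *)
Definition zone (e : {set T}) : I + bool :=
  if [pick i | e \subset C i] is Some i then inl i
  else inr [disjoint e & \bigcup_i C i].

Definition zone_edges (z : I + bool) : {set {set T}} :=
  [set e in edges_in [set: T] | zone e == z].

Hypothesis disC : disjoint_family C.

Lemma zone_inl (e : {set T}) (i : I) :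
  e != set0 -> (zone e == inl i) = (e \subset C i).
Proof.
case/set0Pn=> x xe; rewrite /zone; case: pickP => [j sj|none]; last first.
  by rewrite none.
apply/eqP/idP => [[<-] //|si]; congr inl; apply/eqP; apply: contraTT isT => ij.
have := disjointFr (disjoint_familyP _ disC _ _ ij) (subsetP sj _ xe).
by rewrite (subsetP si).
Qed.

Lemma edge_neq0 (A e : {set T}) : e \in edges_in A -> e != set0.
Proof. by rewrite inE => /andP[_ /eqP e2]; rewrite -card_gt0 e2. Qed.

Lemma zone_edges_inl (i : I) : zone_edges (inl i) = edges_in (C i).
Proof.
apply/setP => e; rewrite !inE subsetT; case: eqVneq => [e2|] /=; last by rewrite andbF.
by rewrite zone_inl ?andbT // -card_gt0 e2.
Qed.

Lemma zone_edges_outside : zone_edges (inr true) = edges_in (~: \bigcup_i C i).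
Proof.
apply/setP => e; rewrite !inE subsetT /= [RHS]andbC; case: eqVneq => //= e2.
rewrite -disjoints_subset /zone; case: pickP => [i si|_] //.
apply/esym/negbTE; apply: contraTN isT => dis.
have /card_gt0P[x xe] : (0 < #|e|)%N by rewrite e2.
have := disjointFr dis xe.
by move/bigcupP; case; exists i => //; apply: (subsetP si).
Qed.

(** An edge that is not a cross pair lies inside some C j or outside the union;
    as the family is disjoint, such an edge lies in C i or avoids it. *)
Lemma components_zones (G : {set {set T}}) :
  G \subset edges_in [set: T] -> (forall i, C i != set0) ->
  [forall i, C i \in components G]
  = (G :&: zone_edges (inr false) == set0)
    && [forall i, spans (C i) (G :&: zone_edges (inl i))].
Proof.
move=> sG C0; have simG : simple_graph G by rewrite simple_graphE.
apply/forallP/andP => [comp|[/eqP cross0 /forallP sp] i]; last first.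
  rewrite mem_components // -zone_edges_inl sp andbT; apply/forall_inP => e eG.
  have eE := subsetP sG _ eG; have [x xe] := set0Pn _ (edge_neq0 eE).
  case zE: (zone e) => [j|[]].
  - move/eqP: zE; rewrite zone_inl ?(edge_neq0 eE) // => ej.
    have [<-|ij] := eqVneq j i; first by rewrite ej.
    apply/orP; right; apply: disjointWl ej _.
    exact: (disjoint_familyP _ disC).
  - move: zE; rewrite /zone; case: pickP => // _ [dis]; apply/orP; right.
    by apply: disjointWr dis; apply: bigcup_sup.
  - have : e \in G :&: zone_edges (inr false).
      by rewrite inE eG inE eE zE eqxx.
    by rewrite cross0 inE.
split; last first.
  apply/forallP => i; have := comp i; rewrite mem_components //.
  by rewrite zone_edges_inl => /andP[].
apply/eqP/setP => e; rewrite !inE; apply: contraTF isT => /andP[eG /andP[_]].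
rewrite /zone; case: pickP => // none /eqP[/negbT].
rewrite disjoint_sym disjoints_subset => /subsetPn[x /bigcupP[i _ xi]].
rewrite inE negbK => xe.
have := comp i; rewrite mem_components // => /andP[/forall_inP/(_ e eG)].
rewrite none /= => dis _.
by have := disjointFr dis xe; rewrite xi.
Qed.

Lemma card_bigcup_disjoint : #|\bigcup_i C i| = (\sum_i #|C i|)%N.
Proof.
rewrite -sum1_card partition_disjoint_bigcup /=; last exact/disjoint_familyP.
by apply: eq_bigr => i _; rewrite sum1_card.
Qed.

Lemma card_zone_cross :
  (#|zone_edges (inr false)| + \sum_i 'C(#|C i|, 2)
   + 'C(#|T| - \sum_i #|C i|, 2) = 'C(#|T|, 2))%N.
Proof.
rewrite -[in RHS]cardsT -card_edges_in -[RHS]sum1_card.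
rewrite (partition_big zone predT) //= big_sumType big_bool /=.
have zE z : (\sum_(e in edges_in [set: T] | zone e == z) 1 = #|zone_edges z|)%N.
  by rewrite sum1dep_card; apply: eq_card => e; rewrite !inE.
rewrite !zE zone_edges_outside card_edges_in cardsCs setCK card_bigcup_disjoint.
under [in RHS]eq_bigr do rewrite zE zone_edges_inl card_edges_in.
by rewrite [in RHS]addnCA addnA addnC addnA addnAC.
Qed.

End Zones.

Lemma prodr_bool (R : comNzRingType) (I : finType) (b : pred I) :
  \prod_i (b i)%:R = [forall i, b i]%:R :> R.
Proof.
have [/forallP bT|/forallPn[i /negPf bi]] := boolP [forall i, b i].
  by apply: big1 => i _; rewrite bT.
by rewrite (bigD1 i) //= bi mul0r.
Qed.

(** Every graph counted by c(#|C|, m) has the same weight. *)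
Lemma sum_spanning_weight (R : comNzRingType) (T : finType) (C : {set T})
    (m : nat) (p : R) :
  \sum_(H : {set {set T}} | H \subset edges_in C)
    (\prod_(e in edges_in C) (if e \in H then p else 1 - p))
    * (spans C H && (#|H| == m))%:R
  = (num_connected #|C| m)%:R * (p ^+ m * (1 - p) ^+ ('C(#|C|, 2) - m)).
Proof.
rewrite -card_spanning_subgraphs -sum1dep_card natr_sum big_distrl /=.
rewrite [RHS](eq_bigl (fun H : {set {set T}} => (H \subset edges_in C)
  && (spans C H && (#|H| == m)))) // [RHS]big_mkcondr /=.
apply: eq_bigr => H sH; rewrite prod_weight // card_edges_in.
by case: andP => [[_ /eqP->]|_]; rewrite ?mulr1 ?mul1r ?mulr0.
Qed.

Lemma er_expectation_components (R : realType) (n q : nat) (p : R)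
    (C : {ffun 'I_q -> {set 'I_n}}) (m : 'I_q -> nat) :
  disjoint_family C -> (forall i, C i != set0) ->
  er_expectation p (fun G =>
    [forall i, (C i \in components G) && (nedges G (C i) == m i)]%:R)
  = \prod_i ((num_connected #|C i| (m i))%:R
             * (p ^+ m i * (1 - p) ^+ ('C(#|C i|, 2) - m i)))
    * (1 - p) ^+ #|zone_edges C (inr false)|.
Proof.
move=> disC C0.
(* The condition on each class: a connected trace with m i edges inside C i,
   no condition outside the union, an empty trace on the cross pairs. *)
pose f (z : 'I_q + bool) (H : {set {set 'I_n}}) : R :=
  match z with
  | inl i => (spans (C i) H && (#|H| == m i))%:R
  | inr b => (b || (H == set0))%:R
  end.
transitivity (\sum_(G : {set {set 'I_n}} | G \subset edges_in [set: 'I_n])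
   (\prod_(e in edges_in [set: 'I_n]) (if e \in G then p else 1 - p))
   * \prod_z f z (G :&: zone_edges C z)).
  apply: eq_big => [G|G]; rewrite simple_graphE // => sG.
  rewrite /er_prob; congr (_ * _).
    by apply: eq_bigl => e; rewrite inE subsetT.
  rewrite big_sumType big_bool /= prodr_bool mul1r -natrM mulnb; congr (nat_of_bool _)%:R.
  rewrite [in RHS]andbC.
  have nE i : nedges G (C i) = #|G :&: zone_edges C (inl i)|.
    rewrite zone_edges_inl //; apply: eq_card => e; rewrite !inE.
    case: (boolP (e \in G)) => //= eG.
    by have := subsetP sG e eG; rewrite inE => /andP[_ ->]; rewrite andbT.
  transitivity ([forall i, C i \in components G]
      && [forall i, nedges G (C i) == m i]).
    apply/forallP/andP => [h|[/forallP h1 /forallP h2] i]; last by rewrite h1 h2.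
    by split; apply/forallP => i; case/andP: (h i).
  rewrite components_zones // -andbA; congr (_ && _).
  apply/andP/forallP => [[/forallP h1 /forallP h2] i|h]; first by rewrite h1 -nE h2.
  by split; apply/forallP => i; case/andP: (h i) => // _; rewrite -nE.
rewrite (sum_subsets_partition _ _ (fun _ b => if b then p else 1 - p)).
rewrite big_sumType big_bool /=; congr (_ * _).
  by apply: eq_bigr => i _; rewrite -/(zone_edges C _) zone_edges_inl // sum_spanning_weight.
under eq_bigr do rewrite mulr1.
rewrite sum_subsets_weight mul1r.
rewrite (bigD1 set0) ?sub0set //= eqxx mulr1 [X in _ + X]big1 => [|H]; last first.
  by case/andP=> _ /negPf->; rewrite mulr0.
by rewrite addr0 prod_weight ?sub0set // cards0 expr0 mul1r subn0.
Qed.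

(** * Summation over tuples *)

Lemma sp_eqE (T : finType) (G : {set {set T}}) (C : {set T}) (k r : nat) :
  (0 < k)%N ->
  (#|C| == k) && (sp G C == r%:Z)
  = (#|C| == k) && (nedges G C == k + r - 1)%N.
Proof.
move=> k0; case: eqP => //= Ck.
by rewrite /sp Ck; apply/eqP/eqP => h; lia.
Qed.

(** Distinct components are disjoint since they are blocks of a partition;
    conversely, disjoint sets are distinct since each k i is positive. *)
Lemma component_tuplesE (T : finType) (G : {set {set T}}) (q : nat)
    (k r : 'I_q -> nat) (C : {ffun 'I_q -> {set T}}) :
  (forall i, 0 < k i)%N ->
  (injectiveb C && [forall i, C i \in components G])
  && [forall i, (#|C i| == k i) && (sp G (C i) == (r i)%:Z)]
  = (C \in disjoint_tuples [set: T] k)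
  && [forall i, (C i \in components G) && (nedges G (C i) == k i + r i - 1)%N].
Proof.
move=> k0; rewrite in_disjoint_tuples; apply/idP/idP.
  case/andP=> /andP[/injectiveP Cinj /forallP comp] /forallP h.
  have {}h i := etrans (esym (sp_eqE G (C i) (r i) (k0 i))) (h i).
  have /and3P[_ /trivIsetP triv _] := components_partition G.
  apply/andP; split; last first.
    by apply/forallP => i; rewrite comp; case/andP: (h i).
  apply/andP; split; last by apply/forallP => i; rewrite subsetT; case/andP: (h i).
  apply/disjoint_familyP => i j ij; apply: triv => //.
  by rewrite (inj_eq Cinj).
case/andP=> /andP[/disjoint_familyP dis /forallP card] /forallP h.
have Ck i : #|C i| == k i by have /andP[] := card i.
apply/andP; split; last first.
  by apply/forallP => i; rewrite sp_eqE // Ck; case/andP: (h i).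
apply/andP; split; last by apply/forallP => i; case/andP: (h i).
apply/injectiveP => i j ij; apply/eqP; apply: contraT => /dis.
rewrite -ij -setI_eq0 setIid -cards_eq0 (eqP (Ck i)) => /eqP ki0.
by have := k0 i; rewrite ki0.
Qed.

Lemma L_disjoint_tuples (R : realType) (lambda : R) (n q : nat)
    (k r : 'I_q -> nat) :
  (forall i, 0 < k i)%N ->
  L lambda n k r
  = \sum_(C in disjoint_tuples [set: 'I_n] k)
      er_expectation (p_crit lambda n) (fun G =>
        [forall i, (C i \in components G)
                   && (nedges G (C i) == k i + r i - 1)%N]%:R).
Proof.
move=> k0; rewrite /L /er_expectation [RHS]exchange_big /=.
apply: eq_bigr => G _; rewrite -mulr_sumr; congr (_ * _).
rewrite [LHS]big_mkcond [RHS]big_mkcond /=; apply: eq_bigr => C _.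
have := component_tuplesE G r C k0; rewrite prodr_bool.
by case: ifP => _; case: ifP => _ //=; first [by move->|by move<-].
Qed.

(** The number of pairs of points, among n, that meet the union of disjoint sets
    of sizes k i without lying in one of them. *)
Definition cross_pairs (q n : nat) (k : 'I_q -> nat) : nat :=
  ('C(n, 2) - 'C(n - \sum_(i < q) k i, 2) - \sum_(i < q) 'C(k i, 2))%N.

Lemma L_formula (R : realType) (lambda : R) (n q : nat) (k r : 'I_q -> nat) :
  (forall i, 0 < k i)%N ->
  L lambda n k r
  = (n ^_ (\sum_(i < q) k i))%:R / (\prod_(i < q) (k i)`!)%:R
    * \prod_(i < q) ((num_connected (k i) (k i + r i - 1))%:R
        * (p_crit lambda n ^+ (k i + r i - 1)
           * (1 - p_crit lambda n) ^+ ('C(k i, 2) - (k i + r i - 1))))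
    * (1 - p_crit lambda n) ^+ cross_pairs n k.
Proof.
move=> k0; rewrite L_disjoint_tuples //; set p := p_crit _ _.
have := card_disjoint_tuples [set: 'I_n] k; rewrite cardsT card_ord => <-.
rewrite natrM mulfK; last first.
  by rewrite pnatr_eq0 -lt0n; apply: prodn_gt0 => i; apply: fact_gt0.
rewrite -mulrA mulr_natl -sumr_const; apply: eq_bigr => C.
rewrite in_disjoint_tuples => /andP[disC /forallP h].
have Ck i : #|C i| = k i by have /andP[_ /eqP] := h i.
rewrite er_expectation_components //; last first.
  by move=> i; rewrite -cards_eq0 Ck -lt0n.
congr (_ * _ ^+ _); first by apply: eq_bigr => i _; rewrite Ck.
have := card_zone_cross disC; rewrite card_ord.
under eq_bigr do rewrite Ck.
under [in X in (_ - X)%N]eq_bigr do rewrite Ck.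
by rewrite /cross_pairs => <-; rewrite addnK addnK.
Qed.

(** * Arithmetic of the exponents *)

Lemma num_connected_gt (k m : nat) : ('C(k, 2) < m)%N -> num_connected k m = 0%N.
Proof.
move=> km; apply/eqP; rewrite cards_eq0 -subset0; apply/subsetP => G.
rewrite !inE => /and3P[]; rewrite simple_graphE => /subset_leq_card.
by rewrite card_edges_in cardsT card_ord => le _ /eqP Gm; move: km; rewrite ltnNge -Gm le.
Qed.

(** Pairs of points of a disjoint union of sets of sizes a and b. *)
Lemma bin2D (a b : nat) : 'C(a + b, 2) = ('C(a, 2) + 'C(b, 2) + a * b)%N.
Proof.
elim: a => [|a IHa]; first by rewrite bin0n mul0n addn0.
by rewrite addSn !binS !bin1 IHa; lia.
Qed.

Lemma bin2_big_sum (q : nat) (k : 'I_q -> nat) :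
  'C(\sum_(i < q) k i, 2)
  = (\sum_(i < q) 'C(k i, 2) + \sum_(i < q) \sum_(j < q | i < j) k i * k j)%N.
Proof.
elim: q k => [|q IHq] k; first by rewrite !big_ord0.
have shift (P : pred 'I_q.+1) (F : 'I_q.+1 -> nat) : ~~ P ord0 ->
    (\sum_(j < q.+1 | P j) F j
     = \sum_(j < q | P (lift ord0 j)) F (lift ord0 j))%N.
  by move=> /negPf P0; rewrite big_mkcond big_ord_recl P0 /= add0n -big_mkcond.
rewrite !big_ord_recl bin2D IHq shift //= big_distrr /=.
rewrite [X in (_ = _ + (_ + X))%N](eq_bigr (fun i : 'I_q =>
  \sum_(j < q | i < j) k (lift ord0 i) * k (lift ord0 j)))%N.
  rewrite [X in (_ = _ + (X + _))%N](eq_bigl xpredT) //.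
  by rewrite [X in (_ = _ + X)%N]addnC !addnA.
by move=> i _; rewrite shift.
Qed.

Lemma cross_pairsE (q n : nat) (k : 'I_q -> nat) :
  let K := (\sum_(i < q) k i)%N in (K <= n)%N ->
  cross_pairs n k
  = (K * (n - K) + \sum_(i < q) \sum_(j < q | i < j) k i * k j)%N.
Proof.
move=> K Kn; rewrite /cross_pairs -/K -{1}(subnKC Kn) bin2D bin2_big_sum.
by rewrite addnAC addnK -addnA addKn addnC.
Qed.

Lemma natr_bin2 (F : numFieldType) (m : nat) :
  ('C(m, 2))%:R = m%:R * (m%:R - 1) / 2 :> F.
Proof.
elim: m => [|m IHm]; first by rewrite mul0r mul0r.
by rewrite binS bin1 natrD IHm -[m.+1]addn1 natrD; field.
Qed.

Theorem proposition3p2 (R : realType) (lambda : R) (n_lambda : nat)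
    (hn_lambda : forall m : nat, (n_lambda <= m)%N ->
       0 < p_crit lambda m /\ p_crit lambda m < 1)
    (n : nat) (hn : (n_lambda <= n)%N)
    (q : nat) (hq : (1 <= q)%N)
    (k r : 'I_q -> nat) (hk : forall i, (1 <= k i)%N) :
  let K := (\sum_(i < q) k i)%N in
  let Rs := (\sum_(i < q) r i)%N in
  let A := (K * (n - K)
            + \sum_(i < q) \sum_(j < q | i < j) k i * k j
            + \sum_(i < q) ('C(k i, 2) - (k i + r i - 1)))%N in
  let feasible :=
    (K <= n)%N /\ (forall i, (k i + r i - 1 <= 'C(k i, 2))%N) in
  (feasible ->
     L lambda n k r
       = (n ^_ K)%:R / (\prod_(i < q) (k i)`!)%:R
         * (\prod_(i < q) num_connected (k i) (k i + r i - 1))%:R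
         * p_crit lambda n ^+ (K + Rs - q)
         * (1 - p_crit lambda n) ^+ A
     /\ A%:R = K%:R * n%:R - K%:R ^+ 2 / 2 - 3 * K%:R / 2 - Rs%:R + q%:R :> R)
  /\ (~ feasible -> L lambda n k r = 0).
Proof.
move=> K Rs A feasible; have k0 i : (0 < k i)%N := hk i.
have LE := L_formula lambda n r k0; rewrite -/K in LE.
split=> [[Kn kr]|infeas].
  have sum_kr : (K + Rs = \sum_(i < q) (k i + r i - 1) + q)%N.
    rewrite -[X in (_ = _ + X)%N](card_ord q) -sum1_card /K /Rs -!big_split /=.
    by apply: eq_bigr => i _; rewrite subnK // ltn_addr.
  split.
    rewrite LE cross_pairsE // !big_split /= -!expr_sum sum_kr addnK !natr_prod /A.
    by rewrite [in RHS]exprD [X in _ = _ * X]mulrC !mulrA.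
  have sum_C : (\sum_(i < q) ('C(k i, 2) - (k i + r i - 1))
      + \sum_(i < q) (k i + r i - 1) = \sum_(i < q) 'C(k i, 2))%N.
    by rewrite -big_split /=; apply: eq_bigr => i _; rewrite subnK.
  (* Subtraction-free form of the identity for A: A + sum (k i + r i - 1)
     counts the pairs that meet the union of the components. *)
  have AE : (A + (K + Rs) + 'C(n - K, 2) = 'C(n, 2) + q)%N.
    rewrite -[in RHS](subnKC Kn) bin2D bin2_big_sum -/K /A sum_kr; lia.
  have := congr1 (fun x : nat => x%:R : R) AE.
  rewrite /= !natrD !natr_bin2 natrB // => h.
  lra.
have [Kn|nK] := leqP K n; last by rewrite LE ffact_small // !mul0r.
have /existsP[i ki] : [exists i, 'C(k i, 2) < k i + r i - 1]%N.
  apply: contraT; rewrite negb_exists => /forallP h; case: infeas; split=> // i.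
  by rewrite leqNgt; apply: h.
by rewrite LE [X in _ * X * _](bigD1 i) //= num_connected_gt // !mul0r mulr0 mul0r.
Qed.
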